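(* Let $\mathcal{P}\in\mathcal{Q}_n$ be an irreducible, combinatorially symmetric sign pattern with a $0$-diagonal whose signed undirected graph $G$ is a cycle. Then $\mathcal{P}$ is not consistent if any one of the following holds: (i) $G$ has two nonadjacent positively signed edges; (ii) $G$ has more than one maximal signed path of odd length; (iii) $n$ is odd and $G$ has a positively signed edge.
   Context: A sign pattern is a matrix with entries in $\{+,-,0\}$; $\mathcal{Q}_n$ is the set of $n\times n$ sign patterns; $\mathcal{Q}(\mathcal{P})$ is the set of real matrices whose entries have the signs prescribed by $\mathcal{P}=[p_{ij}]$. $\mathcal{P}$ is combinatorially symmetric if $p_{ij}\ne0\iff p_{ji}\neq 0$; $0$-diagonal means $p_{ii}=0$. Its signed undirected graph $G$ has vertices $1,\dots,n$, an edge $\{i,j\}$ ($i\neq j$) iff $p_{ij}\ne0$, signed $p_{ij}p_{ji}$. A maximal signed positive (resp. negative) path is a path consisting of a maximal run of consecutive positive (resp. negative) edges, i.e. it starts at a positive (resp. negative) edge that begins the graph or follows an edge of the other sign, continues through successive edges of that sign, and ends at the last such edge or where an edge of the other sign occurs; a maximal signed path is one of either kind, and its length is its number of edges. $\mathcal{P}$ is consistent if there is $k$ such that every $A\in\mathcal{Q}(\mathcal{P})$ has exactly $k$ real eigenvalues (with algebraic multiplicity). *)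

(* Defs.v *)
From mathcomp Require Import all_boot all_order all_fingroup all_algebra.
From mathcomp Require Import polyrcf.
From mathcomp Require Import reals.

Set Implicit Arguments.
Unset Strict Implicit.
Unset Printing Implicit Defensive.

Import Order.TTheory GRing.Theory Num.Theory.
Local Open Scope ring_scope.

(* The signs +, -, 0 are encoded as the integers 1, -1, 0, so that the product
   of signs is the product of int and the sign of a real number is sgz. *)
Definition sign_pattern (n : nat) (P : 'M[int]_n) : Prop :=
  forall i j, P i j \in [:: 1; -1; 0].

Definition qual_class (R : realType) (n : nat) (P : 'M[int]_n)
    (A : 'M[R]_n) : Prop :=
  forall i j, sgz (A i j) = P i j.

Definition comb_symmetric (n : nat) (P : 'M[int]_n) : Prop :=
  forall i j, (P i j != 0) = (P j i != 0).

Definition zero_diagonal (n : nat) (P : 'M[int]_n) : Prop :=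
  forall i, P i i = 0.

(* After a simultaneous permutation of rows and columns, P has a zero lower
   left block of size (n - k) x k. *)
Definition reducible (n : nat) (P : 'M[int]_n) : Prop :=
  exists (s : 'S_n) (k : nat), (0 < k < n)%N /\
    forall i j : 'I_n, (k <= i)%N -> (j < k)%N -> P (s i) (s j) = 0.

Definition irreducible (n : nat) (P : 'M[int]_n) : Prop := ~ reducible P.

Definition num_real_eigenvalues (R : realType) (n : nat) (A : 'M[R]_n) : nat :=
  (\sum_(x <- rootsR (char_poly A)) mup x (char_poly A))%N.

Definition consistent (R : realType) (n : nat) (P : 'M[int]_n) : Prop :=
  exists k : nat, forall A : 'M[R]_n,
    qual_class P A -> num_real_eigenvalues A = k.

Definition edge (n : nat) (P : 'M[int]_n) : rel 'I_n :=
  [rel i j | (i != j) && (P i j != 0)].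

Definition edge_sign (n : nat) (P : 'M[int]_n) (i j : 'I_n) : int :=
  P i j * P j i.

Definition positive_edge (n : nat) (P : 'M[int]_n) (i j : 'I_n) : Prop :=
  edge P i j /\ edge_sign P i j = 1.

Definition graph_is_cycle (T : finType) (e : rel T) : Prop :=
  exists c : seq T,
    [/\ uniq c, (2 < size c)%N, forall x, x \in c
      & forall x y, e x y = (y == next c x) || (x == next c y)].

Definition path_edges (T : finType) (x : T) (p : seq T) : {set {set T}} :=
  [set f in [seq [set uv.1; uv.2] | uv <- zip (x :: p) p]].

(* The path x :: p (of length size p) has all its edges of sign s, and no
   further edge at either of its end vertices has sign s.  When all the edges
   of a cycle have the same sign, no path satisfies this: in particular the
   paths obtained by deleting one edge of the cycle do not, since the deleted
   edge continues the run. *)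
Definition maximal_run (n : nat) (P : 'M[int]_n) (s : int)
    (x : 'I_n) (p : seq 'I_n) : Prop :=
  [/\ p != [::], uniq (x :: p),
      path [rel u v | edge P u v && (edge_sign P u v == s)] x p
    & forall u v, u \in [:: x; last x p] -> edge P u v ->
        [set u; v] \notin path_edges x p -> edge_sign P u v != s].

Definition maximal_signed_path (n : nat) (P : 'M[int]_n)
    (x : 'I_n) (p : seq 'I_n) : Prop :=
  maximal_run P 1 x p \/ maximal_run P (-1) x p.

Definition two_nonadjacent_positive_edges (n : nat) (P : 'M[int]_n) : Prop :=
  exists i j k l : 'I_n,
    [/\ positive_edge P i j, positive_edge P k l & uniq [:: i; j; k; l]].

(* Paths are compared through their edge sets, so that a path and its reversal
   count as one. *)
Definition several_odd_maximal_signed_paths (n : nat) (P : 'M[int]_n) : Prop :=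
  exists (x : 'I_n) (p : seq 'I_n) (y : 'I_n) (q : seq 'I_n),
    [/\ maximal_signed_path P x p, maximal_signed_path P y q,
        path_edges x p != path_edges y q, odd (size p) & odd (size q)].

(* Main.v *)
(* Let [alpha] and [beta], both 1 or -1, be the products of the entries of [P] along
   the two orientations of the cycle.  Multiplying the forward entries of a matrix
   by [t] and the backward ones by [t^-1] changes the characteristic polynomial only
   in its constant term, by [k (alpha t^n + beta t^-n)] plus a constant, where [k]
   is 1 or -1.  When the constant term tends to infinity in absolute value,
   at most two real roots remain, so a consistent pattern has at most two real
   eigenvalues.  If [n] is even and [alpha beta = -1], the constant term tends
   to both infinities, giving a matrix with no real eigenvalue and one with some.
   On the other hand, perturbing a matrix supported on one positive edge ([n] odd)
   or on two disjoint positive edges ([n] even), whose characteristic polynomial is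
   [(X^2 - 1) X^(n-2)], respectively [(X^2 - 4)(X^2 - 1) X^(n-4)], gives at least
   three real eigenvalues.  Finally, if [n] is even, [alpha beta = 1] and no two
   positive edges are disjoint, then a parity argument shows that no maximal signed
   path is odd. *)

Require Import Defs.
From mathcomp Require Import all_boot all_order all_fingroup all_algebra.
From mathcomp Require Import polyorder polyrcf.
From mathcomp Require Import reals.
From mathcomp Require Import ring lra.

Set Implicit Arguments.
Unset Strict Implicit.
Unset Printing Implicit Defensive.

Import Order.TTheory GRing.Theory Num.Theory.
Local Open Scope ring_scope.

(** * Real roots of polynomials *)

Section RealRoots.

Variable R : rcfType.
Implicit Types (p q : {poly R}) (x : R).

Lemma mem_rootsR p x : p != 0 -> (x \in rootsR p) = root p x.
Proof. by move=> /roots_on_rootsR /(_ x); rewrite !inE. Qed.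

Lemma poly_sign_change p (a b : R) : a < b -> p.[a] * p.[b] < 0 ->
  exists2 x, root p x & a < x < b.
Proof.
by move=> /ltW ab pab; have [x] := poly_ivtoo ab pab; rewrite in_itv; exists x.
Qed.

Lemma size_roots_le_count p (s : seq R) : p != 0 -> uniq s -> all (root p) s ->
  (size s <= \sum_(x <- rootsR p) mup x p)%N.
Proof.
move=> p0 us /allP sp.
have leR : (size s <= size (rootsR p))%N.
  by apply: uniq_leq_size us _ => x /sp; rewrite mem_rootsR.
apply: leq_trans leR _; rewrite -sum1_size big_seq [leqRHS]big_seq leq_sum // => x.
by rewrite mem_rootsR // -XsubC_dvd // dvdp_XsubCl.
Qed.

(** A square factor at [x] would make the derivative vanish there. *)
Lemma mup_simple_root p x : root p x -> ~~ root p^`() x -> mup x p = 1%N.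
Proof.
move=> px p'x; have p0 : p != 0.
  by apply: contraNneq p'x => ->; rewrite derivC root0.
apply/eqP; rewrite eqn_leq mup_leq // -XsubC_dvd // dvdp_XsubCl px andbT.
apply: contra p'x => /dvdpP[r ->].
rewrite /root expr2 !derivM derivB derivX derivC subr0.
by rewrite !(hornerD, hornerM, hornerN, hornerX, hornerC, subrr, mulr0, mul0r, addr0).
Qed.

(* The derivative does not depend on [c]: for large [c] all real roots lie
   beyond its zeros, hence are simple, with at most one on either side. *)
Lemma count_roots_sub_large_const p : (1 < size p)%N ->
  exists K : R, forall c, K < `|c| ->
    (\sum_(x <- rootsR (p - c%:P)) mup x (p - c%:P) <= 2)%N.
Proof.
move=> sp; set M := cauchy_bound p^`().
have p'0 : p^`() != 0.
  rewrite -size_poly_eq0 size_deriv -lt0n; case: (size p) sp => [|[]] //.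
(* [[- M, M]] contains all zeros of the derivative and [K] bounds [p] on it, so [p = c] has no
   solution there once [|c| > K]. *)
have [K pK] := poly_itv_bound p (- M) M; exists K => c Kc.
set q := p - c%:P; have q' : q^`() = p^`() by rewrite derivB derivC subr0.
have q0 : q != 0 by apply: contraNneq p'0 => qE; rewrite -q' qE derivC.
have qM x : root q x -> M < `|x|.
  rewrite /root !hornerE subr_eq0 => /eqP pxc; rewrite ltNge ler_norml.
  by apply: contraTN Kc => /pK; rewrite pxc -leNgt.
have p'M x : M <= `|x| -> ~~ root p^`() x.
  by apply: contraTN => /eqP /(cauchy_boundP p'0); rewrite ltNge.
have -> : (\sum_(x <- rootsR q) mup x q = size (rootsR q))%N.
  rewrite -sum1_size !big_seq; apply: eq_bigr => x; rewrite mem_rootsR // => qx.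
  by rewrite mup_simple_root // q' p'M // ltW // qM.
have M0 : 0 <= M by exact: cauchy_bound_ge0.
have one_side x y : root q x -> root q y -> (0 < x) = (0 < y) -> x < y -> False.
  move=> qx qy xy lt_xy.
  have [z zxy] : {z | z \in `]x, y[ & q^`().[z] = 0}.
    by apply: poly_rolle => //; rewrite (eqP qx) (eqP qy).
  move=> /eqP; rewrite q'; apply/negP/p'M.
  move: zxy; rewrite in_itv => /andP[xz zy].
  have [x0|x0] := ltP 0 x.
    apply: ltW; apply: lt_trans (qM _ qx) _.
    by rewrite !gtr0_norm // (lt_trans x0).
  apply: ltW; apply: lt_trans (qM _ qy) _.
  have y0 : y <= 0 by rewrite leNgt -xy -leNgt.
  by rewrite !ler0_norm ?ltrN2 // ltW // (lt_le_trans zy).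
(* The sign bit embeds the set of roots into [bool], hence the bound two. *)
have inj : {in rootsR q &, injective (fun x => 0 < x)}.
  move=> x y; rewrite !mem_rootsR // => qx qy xy.
  by case: (ltgtP x y) => // /one_side []; rewrite // xy.
rewrite -(size_map (fun x => 0 < x)) -card_bool.
rewrite cardE; apply: uniq_leq_size => [|b _]; last by rewrite mem_enum.
by rewrite map_inj_in_uniq // uniq_roots.
Qed.

(** An odd size is an even degree: [p] is nonnegative far out on both sides, and bounded on the
    compact interval in between. *)
Lemma poly_even_bounded_below p : p \is monic -> (1 < size p)%N ->
  odd (size p) -> exists K : R, forall x, K <= p.[x].
Proof.
move=> /monicP pm sp op.
have [a pa] : exists a, forall x, x >= a -> p.[x] >= 0.
  by apply: poly_lim_infty; rewrite ?pm.
have [b pb] : exists b, forall x, x >= b -> (p \Po - 'X).[x] >= 0.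
  apply: poly_lim_infty; last by rewrite size_comp_poly2 // size_polyN size_polyX.
  rewrite lead_coef_comp ?size_polyN ?size_polyX // pm lead_coefN lead_coefX.
  by case: (size p) op => //= n on; rewrite mul1r -signr_odd (negbTE on).
have [K pK] := poly_itv_bound p (- b) a.
exists (- `|K|) => x; have [|xa] := leP a x.
  by move=> /pa; apply: le_trans; rewrite oppr_le0.
have [|xb] := leP x (- b).
  rewrite lerNr => /pb; rewrite horner_comp !hornerE opprK; apply: le_trans.
  by rewrite oppr_le0.
have : `|p.[x]| <= `|K| by rewrite (le_trans _ (ler_norm _)) // pK // !ltW.
by rewrite ler_norml => /andP[].
Qed.

Lemma no_root_sub_neg_const p : p \is monic -> (1 < size p)%N ->
  odd (size p) -> exists K : R, forall c, c < K -> rootsR (p - c%:P) = [::].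
Proof.
move=> pm sp op; have [K pK] := poly_even_bounded_below pm sp op.
exists K => c cK; have p0 : p - c%:P != 0.
  by rewrite subr_eq0; apply: contraTneq sp => ->; rewrite -leqNgt size_polyC_leq1.
case E: (rootsR _) => [//|x s].
have : x \in rootsR (p - c%:P) by rewrite E mem_head.
rewrite mem_rootsR // /root !hornerE subr_eq0 => /eqP px.
by have := pK x; rewrite px leNgt cK.
Qed.

Lemma root_sub_large_const p : p \is monic -> (1 < size p)%N ->
  exists K : R, forall c, K < c ->
    (0 < \sum_(x <- rootsR (p - c%:P)) mup x (p - c%:P))%N.
Proof.
(* For [c > p.[0]] the difference is negative at [0] and positive far to the right. *)
move=> /monicP pm sp; exists p.[0] => c cK; have p0 : p - c%:P != 0.
  by rewrite subr_eq0; apply: contraTneq sp => ->; rewrite -leqNgt size_polyC_leq1.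
have [a pa] : exists a, forall x, x >= a -> p.[x] >= c + 1.
  by apply: poly_lim_infty; rewrite ?pm.
have [||x px _] := @poly_sign_change (p - c%:P) 0 (Num.max a 1).
- by rewrite lt_max ltr01 orbT.
- rewrite !hornerE nmulr_rlt0 ?subr_lt0 // subr_gt0.
  by rewrite (lt_le_trans _ (pa _ _)) ?ltrDl // le_max lexx.
- by apply: (@size_roots_le_count _ [:: x]); rewrite //= px.
Qed.

Lemma count_roots_sign_changes p (a b c d : R) : a < b -> b < c -> c < d ->
  p.[a] * p.[b] < 0 -> p.[b] * p.[c] < 0 -> p.[c] * p.[d] < 0 ->
  (2 < \sum_(x <- rootsR p) mup x p)%N.
Proof.
move=> ab bc cd /[dup] pN0.
have p0 : p != 0 by apply: contraTneq pN0 => ->; rewrite !hornerE ltxx.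
move=> /(poly_sign_change ab)[x px /andP[ax xb]].
move=> /(poly_sign_change bc)[y py /andP[by_ yc]].
move=> /(poly_sign_change cd)[z pz /andP[cz zd]].
apply: (@size_roots_le_count _ [:: x; y; z]) => //=; last by rewrite px py pz.
by rewrite !inE !lt_eqF //; lra.
Qed.

(** By continuity, finitely many strict inequalities at [0] survive at one common [e > 0], the
    future size of a perturbation. *)
Lemma poly_near0 (s : seq {poly R}) : all (fun p => 0 < p.[0]) s ->
  exists2 e, 0 < e & all (fun p => 0 < p.[e]) s.
Proof.
move=> sp.
have [d d0 dP] : exists2 d, 0 < d & forall e, `|e| < d ->
    all (fun p => 0 < p.[e]) s.
  elim: s sp => [_|p s IHs /= /andP[p0 /IHs[d d0 dP]]]; first by exists 1.
  have [d' d'0 d'P] := poly_cont 0 p p0.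
  exists (Num.min d d') => [|e]; first by rewrite lt_min d0.
  rewrite lt_min => /andP[/dP -> ed']; rewrite andbT.
  have := d'P e; rewrite subr0 => /(_ ed'); rewrite ltr_distl subrr.
  by case/andP.
exists (d / 2); first by rewrite divr_gt0.
by apply: dP; rewrite gtr0_norm ?divr_gt0 // ltr_pdivrMr // ltr_pMr // ltr1n.
Qed.

End RealRoots.

(** * Cycles and maximal signed paths *)

Section CyclicOrder.

Variables (T : finType) (c : seq T).
Hypotheses (c_uniq : uniq c) (c_size : (2 < size c)%N) (c_all : forall x, x \in c).

Lemma next_neq x : next c x != x.
Proof.
have [i s cE] := rot_to (c_all x).
rewrite -(next_rot i c_uniq) cE.
have : uniq (rot i c) by rewrite rot_uniq.
have : (2 < size (rot i c))%N by rewrite size_rot.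
rewrite cE; case: s {cE} => [|y s] //= _; rewrite eqxx inE negb_or.
by case/andP => /andP[]; rewrite eq_sym.
Qed.

(** Length at least three is essential: on a cycle of length two, [next] is an involution. *)
Lemma next_next_neq x : next c (next c x) != x.
Proof.
have [i s cE] := rot_to (c_all x).
rewrite -!(next_rot i c_uniq) cE.
have : uniq (rot i c) by rewrite rot_uniq.
have : (2 < size (rot i c))%N by rewrite size_rot.
rewrite cE; case: s {cE} => [|y [|z s]] //= _; rewrite !eqxx !inE !negb_or.
by case/and3P => /and3P[xy xz _] _ _; rewrite [y == x]eq_sym (negbTE xy) eq_sym.
Qed.

(** Induction around the cycle: every element is an iterate of [next] from [x]. *)
Lemma next_closed_all (S : T -> Prop) x :
  (forall y, S y -> S (next c y)) -> S x -> forall y, S y.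
Proof.
move=> SS Sx y; have := fconnect_cycle (cycle_next c_uniq) (c_all x) y.
by rewrite c_all => /iter_findex <-; elim: (findex _ _ _) => //= k; apply: SS.
Qed.

(** Colour by the parity of the index; even length makes this consistent at the step from the last
    element back to the first. *)
Lemma even_cycle_coloring : ~~ odd (size c) ->
  exists col : T -> bool, forall x, col (next c x) = ~~ col x.
Proof.
move=> ev; exists (fun x => odd (index x c)) => x.
rewrite next_nth c_all; case: c c_uniq c_all ev => [|y s] us alls ev.
  by have := alls x.
have: (index x (y :: s) < size (y :: s))%N by rewrite index_mem.
rewrite /= ltnS leq_eqVlt => /predU1P[->|lt_s].
  (* Here [x] is the last element, and the default value of [nth] is the head [y], of index [0]. *)
  by rewrite nth_default //= eqxx; move: ev; rewrite /= => /negbNE ->.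
have nths : nth y s (index x (y :: s)) = nth y (y :: s) (index x (y :: s)).+1 by [].
have := index_uniq y (_ : ((index x (y :: s)).+1 < size (y :: s))%N) us.
by rewrite -nths /= => ->.
Qed.

End CyclicOrder.

Lemma zip_behead_rcons (T : Type) (x z : T) (p : seq T) :
  zip (x :: rcons p z) (rcons p z) = rcons (zip (x :: p) p) (last x p, z).
Proof. by elim: p x => //= y p IHp x; rewrite IHp. Qed.

Lemma mem_zip_path (T : eqType) (x : T) (p : seq T) (uv : T * T) :
  uv \in zip (x :: p) p -> uv.1 \in x :: p /\ uv.2 \in p.
Proof.
elim: p x => //= y p IHp x; rewrite inE => /predU1P[->|/IHp[u v]]; rewrite !inE /=.
  by rewrite !eqxx.
by rewrite -in_cons u orbT v orbT.
Qed.

Lemma eq_set2l (T : finType) (v z u : T) : [set v; z] = [set v; u] -> z = u.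
Proof.
move=> E; have: z \in [set v; u] by rewrite -E set22.
have: u \in [set v; z] by rewrite E set22.
by rewrite !inE => /orP[/eqP ->|/eqP //] /orP[]/eqP.
Qed.

(** Since the vertices are distinct, an end vertex lies on a single edge of the path. The
    disjunction covers both orientations: the path leaves its first vertex and enters its last
    one. *)
Lemma path_end_edge (T : finType) (e : rel T) x p v :
    p != [::] -> uniq (x :: p) -> path e x p -> v \in [:: x; last x p] ->
  exists2 u, e v u || e u v & forall z, z != u -> [set v; z] \notin path_edges x p.
Proof.
move=> p0 up ep; rewrite !inE => /orP[/eqP->|/eqP->] {v}.
  case: p p0 up ep => // y p _ /andP[xp _] /andP[exy _]; exists y; rewrite ?exy //.
  move=> z zy; rewrite /path_edges inE; apply/mapP => -[[u v] /=].
  rewrite inE => /predU1P[[-> ->]|].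
    by move/eq_set2l/eqP; apply/negP.
  move=> /mem_zip_path/= [uy vp] E; have: x \in [set u; v] by rewrite -E set21.
  rewrite !inE => /orP[/eqP xE|/eqP xE]; first by rewrite xE uy in xp.
  by rewrite xE inE vp orbT in xp.
elim/last_ind: p p0 up ep => // p l _ _ up ep.
move: ep; rewrite rcons_path last_rcons => /andP[_ el].
exists (last x p) => [|z zp]; first by rewrite el orbT.
rewrite /path_edges inE; apply/mapP => -[[u v] /=].
rewrite zip_behead_rcons mem_rcons inE => /predU1P[[-> ->]|].
  by rewrite [RHS]setUC => /eq_set2l/eqP; apply/negP.
move=> /mem_zip_path/= [uy vp] E; have: l \in [set u; v] by rewrite -E set21.
move: up; rewrite -rcons_cons rcons_uniq => /andP[lp _].
rewrite !inE => /orP[/eqP lE|/eqP lE]; first by rewrite lE uy in lp.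
by rewrite lE inE vp orbT in lp.
Qed.

(** * Edge signs around a cyclic pattern *)

Section CyclePattern.

Variables (n : nat) (P : 'M[int]_n) (c : seq 'I_n).
Hypotheses (Psign : sign_pattern P) (Psym : comb_symmetric P).
Hypotheses (c_uniq : uniq c) (c_size : (2 < size c)%N) (c_all : forall x, x \in c).
Hypothesis (Pedge : forall x y, edge P x y = (y == next c x) || (x == next c y)).

Let nx := next c.
Let pv := prev c.
(** Edges are indexed by their starting vertex, so the two edges at [v] have signs [es (pv v)] and
    [es v]. *)
Let es i := edge_sign P i (nx i).

Let nxK : cancel nx pv. Proof. exact: prev_next. Qed.
Let pvK : cancel pv nx. Proof. exact: next_prev. Qed.

Lemma size_cycle : size c = n.
Proof.
by rewrite -(card_uniqP c_uniq) (eq_card (_ : c =i predT)) ?card_ord // => x;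
  rewrite c_all.
Qed.

Lemma edge_signC i j : edge_sign P i j = edge_sign P j i.
Proof. exact: mulrC. Qed.

Lemma edge_sym i j : edge P i j = edge P j i.
Proof. by rewrite /edge /= eq_sym Psym. Qed.

Lemma edge_sgn i j : edge P i j -> P i j = 1 \/ P i j = -1.
Proof.
case/andP => _; have := Psign i j; rewrite !inE.
by case/or3P => /eqP ->; [left | right | ].
Qed.

Lemma edge_sign_sgn i j : edge P i j -> edge_sign P i j = 1 \/ edge_sign P i j = -1.
Proof.
rewrite /edge_sign => eij; have eji := eij; rewrite edge_sym in eji.
by case: (edge_sgn eij) (edge_sgn eji) => [->|->] [->|->];
  rewrite ?mulr1 ?mulrN1 ?opprK; auto.
Qed.

Lemma edge_next i : edge P i (nx i).
Proof. by rewrite Pedge eqxx. Qed.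

Lemma es_sgn i : es i = 1 \/ es i = -1.
Proof. exact/edge_sign_sgn/edge_next. Qed.

Lemma positive_next i : es i = 1 -> positive_edge P i (nx i).
Proof. by split => //; apply: edge_next. Qed.

(** One of the two cycle edges at [v] is on the path; the other is off it, so maximality gives it
    the opposite sign. *)
Lemma maximal_path_end x p v : maximal_signed_path P x p ->
  v \in [:: x; last x p] -> es (pv v) = - es v.
Proof.
move=> mx vx.
have {mx} [s [p0 up ep mx]] : exists s, maximal_run P s x p.
  by case: mx; [exists 1 | exists (-1)].
have [u euv uP] := path_end_edge p0 up ep vx.
have {euv} [evu su] : edge P v u /\ edge_sign P v u = s.
  by case/orP: euv => /andP[+ /eqP <-]; rewrite // edge_sym edge_signC.
have other z : z != u -> edge P v z -> edge_sign P v z != s.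
  by move=> zu vz; apply: mx => //; apply: uP.
have pvv : es (pv v) = edge_sign P v (pv v).
  by rewrite /es pvK edge_signC.
have evp : edge P v (pv v) by rewrite Pedge -!/(nx _) pvK eqxx orbT.
have pn : pv v != nx v.
  by rewrite -(inj_eq (can_inj nxK)) pvK eq_sym; apply: next_next_neq.
have neq : es v != es (pv v).
  rewrite pvv /es; move: evu; rewrite Pedge => /orP[/eqP uE|/eqP vE].
    rewrite /nx -uE su eq_sym; apply: other => //.
    by rewrite uE.
  have -> : pv v = u by rewrite vE; apply: nxK.
  rewrite su; apply: other; last exact: edge_next.
  by rewrite eq_sym -(_ : pv v = u) // vE; apply: nxK.
by case: (es_sgn v) (es_sgn (pv v)) neq => [->|->] [->|->].
Qed.

(** Every edge changes the colour, in whichever direction it is traversed. *)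
Lemma color_path (col : 'I_n -> bool) (s : int) x p :
    (forall x, col (nx x) = ~~ col x) ->
    path [rel u v | edge P u v && (edge_sign P u v == s)] x p ->
  col (last x p) = col x (+) odd (size p).
Proof.
move=> colP; elim: p x => [|y p IHp] x /=; first by rewrite addbF.
case/andP => /andP[exy _] /IHp ->; move: exy; rewrite Pedge.
by case/orP => /eqP ->; rewrite -/nx colP; case: (col _); case: (odd _).
Qed.

Lemma sign_change_positive v : es (pv v) = - es v ->
  exists2 i, es i = 1 & v = i \/ v = nx i.
Proof.
case: (es_sgn v) => ev vv; [exists v | exists (pv v)]; rewrite ?vv ?ev ?opprK //.
  by left.
by right; rewrite pvK.
Qed.

Lemma maximal_path_positive x p : maximal_signed_path P x p -> exists i, es i = 1.
Proof.
move=> /maximal_path_end/(_ (mem_head _ _))/sign_change_positive[i es1 _].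
by exists i.
Qed.

(** The remaining edges contribute [n - 1] factors [-1], an odd number. *)
Lemma unique_positive_prod a : ~~ odd n -> es a = 1 ->
  (forall d, d != a -> es d = -1) -> \prod_i es i = -1.
Proof.
move=> evn a1 neg; rewrite (bigD1 a) //= a1 mul1r (eq_bigr (fun=> -1)) //.
have := cardC (pred1 a); rewrite card1 card_ord prodr_const => /(congr1 odd).
by rewrite oddD (negbTE evn) /= -signr_odd => /negbFE ->.
Qed.

(* The ends of a maximal signed path are the vertices where the sign changes.
   If the positive edges are pairwise adjacent and even in number, there are two
   of them, [a] and [next a], so the signs change only at the two outer ends of
   this pair, and these have the same colour. *)
Lemma odd_maximal_path_even x p : ~~ odd n -> maximal_signed_path P x p ->
    odd (size p) ->
  two_nonadjacent_positive_edges P \/ \prod_i es i = -1.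
Proof.
move=> evn mx oddp.
have adj a b : es a = 1 -> es b = 1 -> [\/ a = b, b = nx a, a = nx b |
    two_nonadjacent_positive_edges P].
  move=> /positive_next pa /positive_next pb.
  case: (eqVneq a b) => [|ab]; first by constructor 1.
  case: (eqVneq b (nx a)) => [|bna]; first by constructor 2.
  case: (eqVneq a (nx b)) => [|anb]; first by constructor 3.
  constructor 4; exists a, (nx a), b, (nx b); split => //=.
  rewrite !inE !negb_or ab anb eq_sym [nx a == b]eq_sym bna.
  rewrite (inj_eq (can_inj nxK)) ab [b == _]eq_sym.
  by rewrite !next_neq.
have [col colP] : exists col : 'I_n -> bool, forall x, col (nx x) = ~~ col x.
  by apply: even_cycle_coloring; rewrite // size_cycle.
set l := last x p.
have cxl : col l = ~~ col x.
  have [s [_ _ ep _]] : exists s, maximal_run P s x p.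
    by case: mx; [exists 1 | exists (-1)].
  by rewrite (color_path colP ep) oddp addbT.
have sx : es (pv x) = - es x by apply: maximal_path_end mx _; rewrite mem_head.
have sl : es (pv l) = - es l.
  by apply: maximal_path_end mx _; rewrite !inE eqxx orbT.
(* The common vertex of two consecutive positive edges is not a sign change. *)
have nsw v : es v = 1 -> es (nx v) = 1 -> es (pv (nx v)) = - es (nx v) -> False.
  by rewrite nxK => -> ->.
have [a a1 xa] := sign_change_positive sx; have [b b1 lb] := sign_change_positive sl.
have colN v : col v = ~~ col v -> False by case: (col v).
case: (adj a b a1 b1) => [ab|ba|ab|]; last by left.
(* Both ends of the path lie on the positive edge [a]. Either it is the only positive edge, or
   another one, [d], is disjoint from it because both neighbours of [a] are negative. *)
- subst b; case: (boolP [exists d, (d != a) && (es d == 1)]) => [|nod]; last first.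
    right; apply: (unique_positive_prod evn a1) => d da.
    case: (es_sgn d) => // d1; case/negP: nod; apply/existsP.
    by exists d; rewrite da d1 eqxx.
  case/existsP => d /andP[da /eqP d1].
  (* The ends have different colours, so they are the two different vertices of the edge. *)
  have {}xa : a = x /\ nx a = l \/ a = l /\ nx a = x.
    case: xa lb => [xa|xa] [la|la]; [|by left|by right|];
    by exfalso; apply: (colN x); rewrite -{1}cxl la -xa.
  have san : es (nx a) = -1 /\ es (pv a) = -1.
    have sa : es (pv a) = - es a by case: xa => [[-> _]|[-> _]].
    have sna : es (pv (nx a)) = - es (nx a) by case: xa => [[_ ->]|[_ ->]].
    by rewrite sa a1; split=> //; move: sna; rewrite nxK a1 => /eqP;
      rewrite eq_sym eqr_oppLR => /eqP.
  case: (adj a d a1 d1) => [ad|dE|aE|]; last by left.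
  + by rewrite ad eqxx in da.
  + by move: d1; rewrite dE (proj1 san).
  + by move: d1; rewrite -(nxK d) -aE (proj2 san).
(* The middle vertex [nx a] is excluded, so the ends would be [a] and [nx (nx a)], which have the
   same colour. *)
- exfalso; subst b; case: xa => xa; last by apply: (nsw a); rewrite // -xa.
  case: lb => lb; first by apply: (nsw a); rewrite // -lb.
  by apply: (colN l); rewrite {2}cxl lb !colP xa.
- exfalso; subst a; case: lb => lb; last by apply: (nsw b); rewrite // -lb.
  case: xa => xa; first by apply: (nsw b); rewrite // -xa.
  by apply: (colN x); rewrite -{1}cxl xa !colP lb negbK.
Qed.

End CyclePattern.

(** * Scaling a matrix along a cycle *)

Lemma horner_char_poly (F : comNzRingType) n (A : 'M[F]_n) x :
  (char_poly A).[x] = \det (x%:M - A).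
Proof.
rewrite /char_poly -[LHS]/(horner_eval x _) -det_map_mx; congr (\det _).
by apply/matrixP => i j; rewrite !mxE /= /horner_eval;
  rewrite !(hornerD, hornerN, hornerMn, hornerX, hornerC).
Qed.

Lemma prev_closed_all (T : finType) (c : seq T) (S : T -> Prop) x :
    uniq c -> (forall x, x \in c) ->
  (forall y, S y -> S (prev c y)) -> S x -> forall y, S y.
Proof.
move=> uc allc SS; apply: (@next_closed_all _ (rev c)); rewrite ?rev_uniq //.
  by move=> y; rewrite mem_rev.
by move=> y /SS; rewrite next_rev.
Qed.

(* After two consecutive forward steps, staying or stepping back would
   contradict injectivity, so the permutation goes on forward. *)
Lemma forced_rotation (T : finType) (f g : T -> T) (s : {perm T}) i :
    cancel f g -> cancel g f -> (forall x, f x != x) -> (forall x, f (f x) != x) ->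
    (forall S : T -> Prop, (forall y, S y -> S (f y)) -> S i -> forall y, S y) ->
    (forall j, [\/ s j = j, s j = f j | s j = g j]) ->
  s i = f i -> s (f i) = f (f i) -> s =1 f.
Proof.
move=> fK gK f_neq ff_neq Sall sP si sfi j.
suff [] : s j = f j /\ s (f j) = f (f j) by [].
move: j; apply: Sall => // y [sy sfy]; split => //.
case: (sP (f (f y))) => // E; exfalso; move: E.
  by rewrite -{2}sfy => /perm_inj E; have := f_neq (f y); rewrite E eqxx.
by rewrite fK -{2}sy => /perm_inj E; have := ff_neq y; rewrite E eqxx.
Qed.

Section CycleScaling.

Variables (F : fieldType) (n : nat) (c : seq 'I_n) (B : 'M[F]_n).
Hypotheses (c_uniq : uniq c) (c_size : (2 < size c)%N) (c_all : forall x, x \in c).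
Hypothesis (B_supp : forall i j, B i j != 0 -> j = next c i \/ i = next c j).

Let nx := next c.
Let pv := prev c.
Let nxK : cancel nx pv. Proof. exact: prev_next. Qed.
Let pvK : cancel pv nx. Proof. exact: next_prev. Qed.

(** On the support of [B], the [else] branch meets only backward entries. *)
Definition scale_cycle (t : F) : 'M[F]_n :=
  \matrix_(i, j) ((if j == next c i then t else t^-1) * B i j).

Let nx_neq i : nx i != i. Proof. exact: next_neq. Qed.

Let nx2_neq i : nx (nx i) != i. Proof. exact: next_next_neq. Qed.

Let nx_neq_pv i : nx i != pv i.
Proof. by rewrite -(inj_eq (can_inj nxK)) pvK. Qed.

Let pv_neq i : pv i != i.
Proof. by rewrite -(inj_eq (can_inj nxK)) pvK eq_sym. Qed.

Let pv2_neq i : pv (pv i) != i.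
Proof. by rewrite -(inj_eq (can_inj nxK)) pvK eq_sym. Qed.

Let sigma : 'S_n := perm (can_inj nxK).

Let sigmaV i : (sigma^-1)%g i = pv i.
Proof. by apply: (@perm_inj _ sigma); rewrite permKV permE pvK. Qed.

Let B_diag i : B i i = 0.
Proof.
apply/eqP; apply: contraT => /B_supp[] /eqP; rewrite eq_sym => /eqP E;
by have := nx_neq i; rewrite /nx E eqxx.
Qed.

(** Such a permutation only fixes vertices and swaps neighbours: a step not answered by the reverse
    step is followed by another in the same direction, which forces a full rotation. *)
Lemma card_forward_backward (s : 'S_n) :
    (forall i, [\/ s i = i, s i = nx i | s i = pv i]) -> s != sigma ->
    s != (sigma^-1)%g ->
  #|[set i | s i == nx i]| = #|[set i | s i == pv i]|.
Proof.
move=> sP s1 s2.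
suff -> : [set i | s i == pv i] = nx @: [set i | s i == nx i].
  by rewrite card_imset //; apply: can_inj nxK.
apply/setP => i; rewrite -[i]pvK (mem_imset _ _ (can_inj nxK)) !inE nxK pvK.
apply/eqP/eqP => si.
- case: (sP (pv i)) => // E.
    by have := pv_neq i; rewrite -(inj_eq (@perm_inj _ s)) si E eqxx.
    by rewrite E pvK.
  case/negP: s2; apply/eqP/permP => j; rewrite sigmaV.
  apply: (@forced_rotation _ pv nx s i) => // [S SS Si|k]; last first.
    by case: (sP k); [constructor 1|constructor 3|constructor 2].
  exact: prev_closed_all SS Si.
- case: (sP i) => // E.
    by have := pv_neq i; rewrite -(inj_eq (@perm_inj _ s)) si E eqxx.
  case/negP: s1; apply/eqP/permP => j; rewrite permE -/(nx _).
  apply: (@forced_rotation _ nx pv s (pv i)) => // [S SS Si||]; rewrite ?pvK //.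
  exact: next_closed_all SS Si.
Qed.

(** Either [s] leaves the support off the diagonal and both products vanish, or it makes as many
    forward as backward steps and the powers of [t] cancel. *)
Lemma scale_cycle_term t (s : 'S_n) : t != 0 -> s != sigma -> s != (sigma^-1)%g ->
  \prod_i char_poly_mx (scale_cycle t) i (s i) = \prod_i char_poly_mx B i (s i).
Proof.
move=> t0 s1 s2.
case: (boolP [forall i, [|| s i == i, s i == nx i | s i == pv i]]); last first.
  rewrite negb_forall => /existsP[i]; rewrite !negb_or => /and3P[si sn sp].
  have Bi : B i (s i) = 0.
    apply/eqP; apply: contraT => /B_supp[/eqP|E]; first by rewrite (negbTE sn).
    by case/negP: sp; rewrite {2}E -/(nx _) nxK.
  rewrite (bigD1 i) // [RHS](bigD1 i) //= !mxE Bi mulr0 eq_sym (negbTE si).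
  by rewrite subr0 !mul0r.
move=> /forallP sP'.
have sP i : [\/ s i = i, s i = nx i | s i = pv i].
  by case/or3P: (sP' i) => /eqP; [constructor 1|constructor 2|constructor 3].
pose w i : F := (if s i == nx i then t else 1) * (if s i == pv i then t^-1 else 1).
have wE i : char_poly_mx (scale_cycle t) i (s i) = (w i)%:P * char_poly_mx B i (s i).
  rewrite !mxE /w -/nx; case: (sP i) => ->.
  - by rewrite [i == nx i]eq_sym [i == pv i]eq_sym (negbTE (nx_neq i))
      (negbTE (pv_neq i)) B_diag !mulr1 mulr0 mul1r.
  - rewrite eqxx (negbTE (nx_neq_pv i)) [i == nx i]eq_sym (negbTE (nx_neq i)).
    by rewrite !sub0r mulr1 polyCM mulrN.
  - rewrite eqxx eq_sym [pv i == nx i]eq_sym (negbTE (nx_neq_pv i)) (negbTE (pv_neq i)).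
    by rewrite !sub0r mul1r polyCM mulrN.
rewrite (eq_bigr _ (fun i _ => wE i)) big_split /= -[RHS]mul1r; congr (_ * _).
rewrite -rmorph_prod /w big_split /= -!big_mkcond /= !prodr_const.
have := card_forward_backward sP s1 s2; rewrite !cardsE => ->.
by rewrite -exprMn mulfV // expr1n.
Qed.

(** In the Leibniz expansion only the two rotations feel [t], and their terms are constant
    polynomials because rotations avoid the diagonal. *)
Lemma char_poly_scale_cycle : exists2 k : F, k ^+ 2 = 1 & forall t, t != 0 ->
  char_poly (scale_cycle t) = char_poly B -
    (k * ((t ^+ n - 1) * \prod_i B i (next c i)
        + (t^-1 ^+ n - 1) * \prod_i B i (prev c i)))%:P.
Proof.
(* The signature of the rotation, shared by its inverse, times the signs of the [n] entries
   [- A i j], negated to match the subtraction. *)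
pose k : F := - ((-1) ^+ sigma * (-1) ^+ n).
exists k => [|t t0]; first by rewrite sqrrN exprMn !sqrr_sign mulr1.
have s12 : (sigma^-1)%g != sigma.
  have i0 : 'I_n by case: c c_size.
  apply: contraTneq (nx_neq_pv i0) => /permP/(_ i0).
  by rewrite sigmaV permE -/(nx _) => ->; rewrite eqxx.
have detE A : char_poly A = \sum_(s : 'S_n | (s != sigma) && (s != (sigma^-1)%g))
      (-1) ^+ s * \prod_i char_poly_mx A i (s i)
    + (-1) ^+ sigma * (\prod_i char_poly_mx A i (nx i)
       + \prod_i char_poly_mx A i (pv i)) :> {poly F}.
  rewrite /char_poly /determinant (bigD1 sigma) //= (bigD1 (sigma^-1)%g) //=.
  rewrite addrA addrC odd_permV mulrDr; congr (_ + (_ * _ + _ * _)).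
    by apply: eq_bigr => i _; rewrite permE.
  by apply: eq_bigr => i _; rewrite sigmaV.
have prodZ (a : F) G : \prod_(i < n) (a * G i) = a ^+ n * \prod_i G i.
  by rewrite big_split prodr_const card_ord.
have prodN (G : 'I_n -> F) : \prod_i (- G i) = (-1) ^+ n * \prod_i G i.
  by rewrite -prodZ; apply: eq_bigr => i _; rewrite mulN1r.
have fwd A :
    \prod_i char_poly_mx A i (nx i) = ((-1) ^+ n * \prod_i A i (nx i))%:P :> {poly F}.
  rewrite -prodN rmorph_prod; apply: eq_bigr => i _.
  by rewrite !mxE eq_sym (negbTE (nx_neq i)) sub0r -polyCN.
have bwd A :
    \prod_i char_poly_mx A i (pv i) = ((-1) ^+ n * \prod_i A i (pv i))%:P :> {poly F}.
  rewrite -prodN rmorph_prod; apply: eq_bigr => i _.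
  by rewrite !mxE eq_sym (negbTE (pv_neq i)) sub0r -polyCN.
have fwdt : \prod_i scale_cycle t i (nx i) = t ^+ n * \prod_i B i (nx i).
  rewrite -prodZ; apply: eq_bigr => i _.
  by rewrite mxE eqxx.
have bwdt : \prod_i scale_cycle t i (pv i) = t^-1 ^+ n * \prod_i B i (pv i).
  rewrite -prodZ; apply: eq_bigr => i _.
  by rewrite mxE -/nx [_ == nx i]eq_sym (negbTE (nx_neq_pv i)).
have termE (s : 'S_n) : (s != sigma) && (s != (sigma^-1)%g) ->
    (-1) ^+ s * \prod_i char_poly_mx (scale_cycle t) i (s i)
      = (-1) ^+ s * \prod_i char_poly_mx B i (s i).
  by case/andP => s1 s2; rewrite scale_cycle_term.
rewrite !detE (eq_bigr _ termE) -addrA; congr (_ + _).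
rewrite !fwd !bwd fwdt bwdt /k -/nx -/pv.
have -> : (-1) ^+ sigma = ((-1) ^+ sigma : F)%:P by rewrite rmorphXn /= polyCN.
move: (\prod_i B i (nx i)) (\prod_i B i (pv i)) => x y.
move: ((-1) ^+ sigma) ((-1) ^+ n) (t ^+ n) (t^-1 ^+ n) => a b u v.
rewrite -!polyCD -!polyCM -!polyCB.
apply: (congr1 polyC).
ring.
Qed.

End CycleScaling.

(** * Matchings and perturbations *)

(* The sign change [d] conjugates [A] to [- A], so ['X%:M - A] and ['X%:M + A]
   have the same determinant, and their product is diagonal. *)
Lemma char_poly_sqr (F : comNzRingType) n (A : 'M[F]_n) (d : 'rV[F]_n) (D : 'I_n -> F) :
    (forall i, d 0 i ^+ 2 = 1) ->
    (forall i j, d 0 i * A i j * d 0 j = - A i j) ->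
    A *m A = diag_mx (\row_i D i) ->
  char_poly A ^+ 2 = \prod_i ('X^2 - (D i)%:P).
Proof.
move=> d2 dA A2.
pose S := diag_mx (map_mx polyC d).
have S2 : S *m S = 1%:M.
  rewrite mulmx_diag -diag_const_mx; congr diag_mx; apply/rowP => i.
  by rewrite !mxE -polyCM -expr2 d2.
have detS : \det S * \det S = 1 by rewrite -det_mulmx S2 det1.
have SM : S *m char_poly_mx A *m S = 'X%:M + map_mx polyC A.
  apply/matrixP => i j; rewrite mul_mx_diag mul_diag_mx !mxE.
  have [->|ij] := eqVneq i j.
    rewrite !mulr1n mulrBr mulrBl -!polyCM mulrAC -!polyCM -expr2 d2 dA polyCN.
    by rewrite mul1r opprK.
  by rewrite !mulr0n sub0r add0r mulrN mulNr -!polyCM dA polyCN opprK.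
have -> : char_poly A ^+ 2 = \det (char_poly_mx A *m ('X%:M + map_mx polyC A)).
  by rewrite -SM !det_mulmx -[LHS]mul1r -detS /char_poly; ring.
(* A scalar matrix commutes with [A], so the product is the difference of the squares. *)
have -> : char_poly_mx A *m ('X%:M + map_mx polyC A)
    = diag_mx (\row_i ('X^2 - (D i)%:P)).
  rewrite /char_poly_mx mulmxBl !mulmxDr -map_mxM A2 -scalar_mxM scalar_mxC.
  rewrite opprD addrA addrK -expr2.
  apply/matrixP => i j; rewrite !mxE.
  case: eqVneq => [->|_]; first by rewrite !mulr1n.
  by rewrite !mulr0n /= polyC0 subr0.
by rewrite det_diag; apply: eq_bigr => i _; rewrite mxE.
Qed.

(** Extracts the characteristic polynomial from the formula for its square; leading coefficients
    exclude [p = - q]. *)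
Lemma monic_sqr_inj (F : numDomainType) (p q : {poly F}) :
  p \is monic -> q \is monic -> p ^+ 2 = q ^+ 2 -> p = q.
Proof.
move=> /monicP pm /monicP qm /eqP; rewrite eqf_sqr => /orP[/eqP //|/eqP pq].
have := pm; rewrite pq lead_coefN qm => /eqP.
by rewrite -subr_eq0 -opprD oppr_eq0 -(natrD _ 1 1) pnatr_eq0.
Qed.

Section Matching.

Variables (F : numFieldType) (n : nat) (B : 'M[F]_n) (tau : 'S_n) (l : 'I_n -> F).
Hypotheses (tauK : involutive tau) (ltau : forall i, l (tau i) = l i).
Hypothesis B_sign : forall i, l i * B i (tau i) * B (tau i) i = l i.
Variable dsgn : 'I_n -> bool.
Hypothesis dtau : forall i, l i != 0 -> dsgn (tau i) = ~~ dsgn i.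

(** A weighted matching: [tau] swaps the ends of each chosen edge. By [B_sign] the two entries of an
    edge of nonzero weight have product [1]; by [dtau] fixed points of [tau] have weight [0]. *)
Definition matching_mx : 'M[F]_n := \matrix_(i, j) ((l i * B i j) *+ (j == tau i)).

Lemma char_poly_matching_sqr :
  char_poly matching_mx ^+ 2 = \prod_i ('X^2 - (l i ^+ 2)%:P).
Proof.
apply: (@char_poly_sqr _ _ _ (\row_i (-1) ^+ dsgn i)) => [i|i j|].
- by rewrite mxE sqrr_sign.
- rewrite !mxE; have [->|] := eqVneq j (tau i); last by rewrite !mulr0n mulr0 mul0r oppr0.
  have [->|/dtau->] := eqVneq (l i) 0; first by rewrite mul0r mulr0 mul0r oppr0.
  by rewrite mulr1n mulrAC -signr_addb addbN addbb mulN1r.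
- apply/matrixP => i k; rewrite !mxE (bigD1 (tau i)) //= big1 ?addr0 => [|j ji].
    rewrite !mxE eqxx tauK mulr1n eq_sym; case: eqP => [<-|_]; last first.
      by rewrite !mulr0n mulr0.
    rewrite !mulr1n ltau.
    transitivity (l i * (l i * B i (tau i) * B (tau i) i)); first by ring.
    by rewrite B_sign expr2.
  by rewrite !mxE (negbTE ji) mulr0n mul0r.
Qed.

End Matching.

(** For fixed [x], the value at [x] of the characteristic polynomial of [A + e *: B] is a polynomial
    in [e], called [D x] below. *)
Lemma perturb_char_poly_sign (R : rcfType) n (A B : 'M[R]_n) (xs : seq R) :
    all (fun x => (char_poly A).[x] != 0) xs ->
  exists2 e, 0 < e &
    all (fun x => 0 < (char_poly A).[x] * (char_poly (A + e *: B)).[x]) xs.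
Proof.
move=> xs0.
pose D x : {poly R} := \det (\matrix_(i, j) ((x%:M - A) i j)%:P - 'X *: map_mx polyC B).
have DE x e : (D x).[e] = (char_poly (A + e *: B)).[x].
  rewrite horner_char_poly -[LHS]/(horner_eval e _) -det_map_mx; congr (\det _).
  apply/matrixP => i j; rewrite !mxE /= /horner_eval.
  by rewrite !(hornerD, hornerN, hornerM, hornerX, hornerC) opprD addrA.
(* The factor [(char_poly A).[x]] turns the value at [e = 0] into a nonzero square, hence
   positive. *)
have [|e e0 eP] := @poly_near0 _ [seq (char_poly A).[x] *: D x | x <- xs].
  rewrite all_map; apply: sub_all xs0 => x /=.
  by rewrite hornerZ DE scale0r addr0 -expr2 exprn_even_gt0.
exists e => //; move: eP; rewrite all_map; apply: sub_all => x /=.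
by rewrite hornerZ DE.
Qed.

(** Strict sign changes are stable under perturbation, whereas multiple real roots may leave the
    real line. *)
Lemma perturb_three_roots (R : rcfType) n (A B : 'M[R]_n) (a b c d : R) :
    a < b -> b < c -> c < d ->
    (char_poly A).[a] * (char_poly A).[b] < 0 ->
    (char_poly A).[b] * (char_poly A).[c] < 0 ->
    (char_poly A).[c] * (char_poly A).[d] < 0 ->
  exists2 e, 0 < e &
    (2 < \sum_(x <- rootsR (char_poly (A + e *: B))) mup x (char_poly (A + e *: B)))%N.
Proof.
move=> ab bc cd nab nbc ncd.
have [|e e0 /=] := @perturb_char_poly_sign _ _ A B [:: a; b; c; d].
  have neq0 u v : u * v < 0 :> R -> u != 0 /\ v != 0.
    by move=> /ltr0_neq0; rewrite mulf_eq0 negb_or => /andP[].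
  have [an bn] := neq0 _ _ nab; have [cn dn] := neq0 _ _ ncd.
  by rewrite /= an bn cn dn.
case/and5P => pa pb pc pd _; exists e => //.
have tr u v u' v' : 0 < u * u' -> 0 < v * v' -> u * v < 0 -> u' * v' < 0 :> R.
  by move=> uu vv /nmulr_rgt0 <-; rewrite mulrACA mulr_gt0.
apply: count_roots_sign_changes ab bc cd _ _ _;
  by [apply: tr nab|apply: tr nbc|apply: tr ncd].
Qed.

Lemma prod_outside_seq (F : comNzRingType) n (s : seq 'I_n) (G : 'I_n -> F) (g : F) :
    uniq s -> (forall i, i \notin s -> G i = g) ->
  \prod_i G i = \prod_(i <- s) G i * g ^+ (n - size s).
Proof.
move=> us Gg; rewrite (bigID (mem s)) -big_uniq //=; congr (_ * _).
rewrite (eq_bigr (fun=> g)) // prodr_const; congr (_ ^+ _).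
have := cardC (mem s); rewrite card_ord (card_uniqP us) => nE.
by rewrite -[X in (X - _)%N]nE addKn; apply: eq_card.
Qed.

Lemma qual_class_scale (R : realType) n (P : 'M[int]_n)
    (w : 'I_n -> 'I_n -> R) (A : 'M[R]_n) :
    sign_pattern P -> (forall i j, 0 < w i j) ->
    (forall i j, A i j = w i j * (P i j)%:~R) -> qual_class P A.
Proof.
move=> Ps w0 AE i j; rewrite AE sgzM gtr0_sgz // mul1r sgz_int.
by have := Ps i j; rewrite !inE => /or3P[]/eqP->.
Qed.

(** The term [e *: B] restores the signs of the entries outside the matching and agrees in sign with
    those inside. *)
Lemma qual_class_matching (R : realType) n (P : 'M[int]_n)
    (tau : 'S_n) (l : 'I_n -> R) e :
    sign_pattern P -> (forall i, 0 <= l i) -> 0 < e ->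
  qual_class P (matching_mx (map_mx intr P) tau l + e *: map_mx intr P).
Proof.
move=> Psign l0 e0.
apply: (@qual_class_scale _ _ _ (fun i j => l i *+ (j == tau i) + e)) => // i j.
  by rewrite ltr_wpDl // mulrn_wge0.
by rewrite !mxE mulrDl mulrnAl.
Qed.

(** * Matrices with at least three real eigenvalues *)

Section Existence.

Variables (R : realType) (n : nat) (P : 'M[int]_n).
Hypothesis (Psign : sign_pattern P).

Let B : 'M[R]_n := map_mx intr P.

Let BB i j : edge_sign P i j = 1 -> B i j * B j i = 1.
Proof. by rewrite /edge_sign => E; rewrite !mxE -intrM E. Qed.

Lemma three_eigenvalues_odd a a' : odd n -> (2 < n)%N -> a != a' ->
    edge_sign P a a' = 1 ->
  exists2 A : 'M[R]_n, qual_class P A & (2 < num_real_eigenvalues A)%N.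
Proof.
move=> on n2 aa es1; pose tau := tperm a a'.
pose l i : R := (i \in [:: a; a'])%:R.
have usa : uniq [:: a; a'] by rewrite /= inE aa.
have Q2 := @char_poly_matching_sqr _ _ B tau l _ _ _ (pred1 a) _.
have {}Q2 : char_poly (matching_mx B tau l) ^+ 2 = \prod_i ('X^2 - (l i ^+ 2)%:P).
  apply: Q2 => i.
  - exact: tpermK.
  - by rewrite /l /tau !inE; case: tpermP => [->|->|]; rewrite ?eqxx ?orbT.
  - rewrite /l /tau !inE; case: tpermP => [->|->|/eqP/negbTE -> /eqP/negbTE ->].
    + by rewrite eqxx mul1r BB.
    + by rewrite eqxx orbT mul1r BB // edge_signC.
    + by rewrite !mul0r.
  - rewrite /l /tau !inE /=; case: tpermP => [->|->|/eqP/negbTE -> /eqP/negbTE ->].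
    + by rewrite eqxx [a' == a]eq_sym (negbTE aa).
    + by rewrite !eqxx [a' == a]eq_sym aa.
    + by rewrite eqxx.
have QE : char_poly (matching_mx B tau l) = ('X^2 - 1) * 'X^(n - 2).
  apply: monic_sqr_inj; first exact: char_poly_monic.
    by rewrite monicMr ?monicXn // monicXnsubC.
  rewrite Q2 (@prod_outside_seq _ _ [:: a; a'] _ 'X^2) // => [|i ia].
    rewrite !big_cons big_nil /l !inE !eqxx orbT expr1n -exprM mulnC exprM.
    by ring.
  by rewrite /l (negbTE ia) expr0n subr0.
have om : odd (n - 2) by rewrite oddB ?on // ltnW.
pose u (x : R) := x ^+ (n - 2).
have ev x : (char_poly (matching_mx B tau l)).[x] = (x ^+ 2 - 1) * u x.
  by rewrite QE hornerM hornerD hornerN !hornerXn hornerC.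
have uE x : (u x < 0) = (x < 0) by rewrite exprn_odd_lt0.
have uE' x : (0 < u x) = (0 < x) by rewrite exprn_odd_gt0.
(* As [n - 2] is odd, the polynomial changes sign at [-1], [0] and [1], which the four sample points
   separate. *)
have u1 : u (-2) < 0 by rewrite uE; lra.
have u2 : u (- (1 / 2)) < 0 by rewrite uE; lra.
have u3 : 0 < u (1 / 2) by rewrite uE'; lra.
have u4 : 0 < u 2 by rewrite uE'; lra.
have [||||||e e0 lt] :=
  @perturb_three_roots _ _ (matching_mx B tau l) B (-2) (- (1/2)) (1/2) 2.
- lra.
- lra.
- lra.
- by rewrite !ev; nra.
- by rewrite !ev; nra.
- by rewrite !ev; nra.
exists (matching_mx B tau l + e *: B) => //.
by apply: qual_class_matching => // i; rewrite ler0n.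
Qed.

Lemma three_eigenvalues_even a a' b b' : ~~ odd n -> uniq [:: a; a'; b; b'] ->
    edge_sign P a a' = 1 -> edge_sign P b b' = 1 ->
  exists2 A : 'M[R]_n, qual_class P A & (2 < num_real_eigenvalues A)%N.
Proof.
(* The different weights [2] and [1] make the nonzero eigenvalues [-2], [-1], [1], [2] simple. *)
move=> on us es1 es2; pose tau := (tperm a a' * tperm b b')%g.
pose l i : R := (i \in [:: a; a'])%:R * 2 + (i \in [:: b; b'])%:R.
have n4 : (4 <= n)%N.
  by have := max_card (mem [:: a; a'; b; b']); rewrite (card_uniqP us) card_ord.
move: (us); rewrite /= !inE !negb_or => /and4P[/and3P[aa ab ab'] /andP[a'b a'b'] bb _].
have tauE i : [\/ i = a, i = a', i = b | i = b'] \/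
    i \notin [:: a; a'; b; b'] /\ tau i = i.
  case: (boolP (i \in [:: a; a'; b; b'])) => [|ia]; last first.
    right; split => //; move: ia; rewrite !inE !negb_or => /and4P[ia ia' ib ib'].
    by rewrite permM !tpermD // eq_sym.
  rewrite !inE => /or4P[]/eqP->; left;
  by [constructor 1|constructor 2|constructor 3|constructor 4].
have dif := (negbTE aa, negbTE ab, negbTE ab', negbTE a'b, negbTE a'b', negbTE bb).
have dif' : (a' == a = false) * (b == a = false) * (b' == a = false) *
   (b == a' = false) * (b' == a' = false) * (b' == b = false).
  by do !split; rewrite eq_sym dif.
have la : l a = 2 by rewrite /l !inE !eqxx !dif mul1r addr0.
have la' : l a' = 2 by rewrite /l !inE !eqxx !dif !dif' mul1r addr0.
have lb : l b = 1 by rewrite /l !inE !eqxx !dif !dif' mul0r add0r.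
have lb' : l b' = 1 by rewrite /l !inE !eqxx !dif' orbT mul0r add0r.
have l0 i : i \notin [:: a; a'; b; b'] -> l i = 0.
  rewrite /l !inE !negb_or => /and4P[/negbTE-> /negbTE-> /negbTE-> /negbTE->].
  by rewrite mul0r add0r.
have Q2 := @char_poly_matching_sqr _ _ B tau l _ _ _ (mem [:: a; b]) _.
have {}Q2 : char_poly (matching_mx B tau l) ^+ 2 = \prod_i ('X^2 - (l i ^+ 2)%:P).
  have ta : tau a = a' by rewrite permM tpermL tpermD // eq_sym.
  have ta' : tau a' = a by rewrite permM tpermR tpermD // eq_sym.
  have tb : tau b = b' by rewrite permM [X in tperm b b' X]tpermD ?tpermL.
  have tb' : tau b' = b by rewrite permM [X in tperm b b' X]tpermD ?tpermR.
  apply: Q2 => i; case: (tauE i) => [[]->|[E tE]]; rewrite ?tE ?ta ?ta' ?tb ?tb' //.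
  - by rewrite la la'.
  - by rewrite la la'.
  - by rewrite lb lb'.
  - by rewrite lb lb'.
  - by rewrite -mulrA BB // mulr1.
  - by rewrite -mulrA BB ?mulr1 // edge_signC.
  - by rewrite -mulrA BB // mulr1.
  - by rewrite -mulrA BB ?mulr1 // edge_signC.
  - by rewrite l0 // !mul0r.
  - by rewrite !inE !eqxx dif' dif.
  - by rewrite !inE !eqxx dif' dif.
  - by rewrite !inE !eqxx !dif' orbT.
  - by rewrite !inE !eqxx !dif' orbT.
  - by rewrite l0 // eqxx.
have QE : char_poly (matching_mx B tau l) = ('X^2 - 4%:P) * ('X^2 - 1) * 'X^(n - 4).
  apply: monic_sqr_inj; first exact: char_poly_monic.
    by rewrite !monicMr ?monicXn // monicXnsubC.
  rewrite Q2 (@prod_outside_seq _ _ [:: a; a'; b; b'] _ 'X^2) // => [|i ia].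
    rewrite !big_cons big_nil la la' lb lb' expr1n -exprM mulnC exprM.
    by rewrite (_ : 2 ^+ 2 = 4 :> R); [ring | ring].
  by rewrite l0 // expr0n subr0.
have om : ~~ odd (n - 4) by rewrite oddB ?(negbTE on).
pose u (x : R) := x ^+ (n - 4).
have ev x : (char_poly (matching_mx B tau l)).[x] = (x ^+ 2 - 4) * (x ^+ 2 - 1) * u x.
  by rewrite QE !hornerM !hornerD !hornerN !hornerXn !hornerC.
have uP x : 0 < x -> 0 < u x by apply: exprn_gt0.
have uN x : x < 0 -> 0 < u x by move=> x0; rewrite exprn_even_gt0 // (lt_eqF x0) orbT.
(* The even power [n - 4] gives no sign change at [0]; the sample points separate [-2], [-1] and
   [1]. *)
have u1 : 0 < u (-3) by apply: uN; lra.
have u2 : 0 < u (- (3 / 2)) by apply: uN; lra.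
have u3 : 0 < u (1 / 2) by apply: uP; lra.
have u4 : 0 < u (3 / 2) by apply: uP; lra.
have [||||||e e0 lt] :=
  @perturb_three_roots _ _ (matching_mx B tau l) B (-3) (- (3/2)) (1/2) (3/2).
- lra.
- lra.
- lra.
- by rewrite !ev; nra.
- by rewrite !ev; nra.
- by rewrite !ev; nra.
exists (matching_mx B tau l + e *: B) => //.
by apply: qual_class_matching => // i; rewrite addr_ge0 ?mulr_ge0 ?ler0n.
Qed.

End Existence.

(** * Matrices of a cyclic pattern *)

(** With [a] and [b] equal to [1] or [-1], the outer factor [a] makes the dominant term [t ^+ n]
    positive, and the term in [t^-1] stays bounded for [t >= 1]. *)
Lemma scaling_unbounded (R : realFieldType) n (a b K : R) :
    (0 < n)%N -> a ^+ 2 = 1 -> b ^+ 2 = 1 ->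
  exists2 t, 0 < t & K < a * (a * (t ^+ n - 1) + b * (t^-1 ^+ n - 1)).
Proof.
(* The choice gives [t >= 1] and [K <= t - 3], while the expression is at least [t - 2]. *)
move=> n0 a2 b2; exists (`|K| + 3); first by rewrite ltr_wpDl.
set t := _ + 3; have t1 : 1 <= t by rewrite /t; have := normr_ge0 K; lra.
have tn : t <= t ^+ n by rewrite -{1}[t]expr1 ler_weXn2l.
have u0 : 0 <= t^-1 ^+ n by rewrite exprn_ge0 // invr_ge0; lra.
have u1 : t^-1 ^+ n <= 1 by rewrite exprn_ile1 ?invr_ge0 ?invf_le1; lra.
have -> : a * (a * (t ^+ n - 1) + b * (t^-1 ^+ n - 1))
   = t ^+ n - 1 + (a * b) * (t^-1 ^+ n - 1).
  by rewrite -[t ^+ n - 1 in RHS]mul1r -a2; ring.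
have Kt : K <= t - 3 by rewrite /t addrK ler_norm.
have /eqP : (a * b) ^+ 2 = 1 by rewrite exprMn a2 b2 mulr1.
by rewrite sqrf_eq1 => /orP[]/eqP->; lra.
Qed.

Section CycleSpectra.

Variables (R : realType) (n : nat) (P : 'M[int]_n) (c : seq 'I_n).
Hypotheses (Psign : sign_pattern P) (Psym : comb_symmetric P) (Pdiag : zero_diagonal P).
Hypotheses (c_uniq : uniq c) (c_size : (2 < size c)%N) (c_all : forall x, x \in c).
Hypothesis (Pedge : forall x y, edge P x y = (y == next c x) || (x == next c y)).

Let B : 'M[R]_n := map_mx intr P.

(* [a] and [b] are, up to a common sign, the products of the entries of [P] along
   the two orientations of the cycle. *)
Lemma cycle_family : exists a b : R,
  [/\ a ^+ 2 = 1, b ^+ 2 = 1, a * b = (\prod_i edge_sign P i (next c i))%:~R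
    & forall t, 0 < t -> exists2 A : 'M[R]_n, qual_class P A &
      char_poly A = char_poly B - (a * (t ^+ n - 1) + b * (t^-1 ^+ n - 1))%:P].
Proof.
have supp i j : B i j != 0 -> j = next c i \/ i = next c j.
  rewrite mxE intr_eq0 => Pij; have : edge P i j.
    by rewrite /edge /= Pij andbT; apply: contraNneq Pij => ->; rewrite Pdiag.
  by rewrite Pedge => /orP[]/eqP; auto.
have [k k2 kP] := char_poly_scale_cycle c_uniq c_size c_all supp.
have sqr i j : edge P i j -> B i j ^+ 2 = 1.
  by move=> /(edge_sgn Psign); rewrite mxE => -[]->; rewrite ?sqrrN expr1n.
have nx i : edge P i (next c i) by rewrite Pedge eqxx.
have pv i : edge P i (prev c i) by rewrite Pedge next_prev // eqxx orbT.
exists (k * \prod_i B i (next c i)), (k * \prod_i B i (prev c i)); split.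
- by rewrite exprMn k2 mul1r -prodrXl big1 // => i _; apply: sqr.
- by rewrite exprMn k2 mul1r -prodrXl big1 // => i _; apply: sqr.
- rewrite mulrACA -expr2 k2 mul1r rmorph_prod.
  (* Shifting the backward product by one vertex pairs the two entries of each edge. *)
  rewrite [X in _ * X](reindex (next c)) /=; last first.
    by exists (prev c) => i _; [apply: prev_next | apply: next_prev].
  rewrite -big_split; apply: eq_bigr => i _.
  by rewrite prev_next // !mxE /edge_sign intrM.
- move=> t t0; exists (scale_cycle c B t).
    apply: (@qual_class_scale _ _ _ (fun i j => if j == next c i then t else t^-1)) => //.
      by move=> i j; case: ifP; rewrite ?invr_gt0.
    by move=> i j; rewrite !mxE.
  by rewrite kP ?gt_eqF //; congr (_ - _%:P); ring.
Qed.

Lemma size_char_poly_cycle : (1 < size (char_poly B))%N.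
Proof.
by rewrite size_char_poly ltnS -(size_cycle c_uniq c_all) (ltn_trans _ c_size).
Qed.

Let n0 : (0 < n)%N.
Proof. by rewrite -(size_cycle c_uniq c_all) (ltn_trans _ c_size). Qed.

Lemma few_real_eigenvalues :
  exists2 A : 'M[R]_n, qual_class P A & (num_real_eigenvalues A <= 2)%N.
Proof.
have [a [b [a2 b2 _ family]]] := cycle_family.
have [K KP] := count_roots_sub_large_const size_char_poly_cycle.
have [t t0 tK] := scaling_unbounded K n0 a2 b2.
have [A PA AE] := family t t0; exists A => //.
rewrite /num_real_eigenvalues AE; apply: KP; apply: lt_le_trans tK _.
(* Since [|a| = 1], a lower bound on [a * x] bounds [|x|]. *)
set x := _ + _; rewrite (le_trans (ler_norm _)) // normrM.
have /eqP : a ^+ 2 = 1 by [].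
by rewrite sqrf_eq1 => /orP[]/eqP->; rewrite ?normrN normr1 mul1r.
Qed.

(** As [a * b = -1], the subtracted constant takes arbitrarily large values of both signs. In even
    degree, large positive ones leave a real root and large negative ones leave none. *)
Lemma negative_product_not_consistent : ~~ odd n ->
  \prod_i edge_sign P i (next c i) = -1 -> ~ consistent R P.
Proof.
move=> evn prodN [k kP]; have [a [b [a2 b2 ab family]]] := cycle_family.
have mon := char_poly_monic B.
have [K1 K1P] := root_sub_large_const mon size_char_poly_cycle.
have [K0 K0P] : exists K, forall x, x < K -> rootsR (char_poly B - x%:P) = [::].
  by apply: no_root_sub_neg_const; rewrite ?size_char_poly_cycle // size_char_poly /= evn.
have {prodN} : a * b = -1 by rewrite ab prodN.
(* Replacing [t] by [t^-1] exchanges the roles of [a] and [b]. *)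
have unb K : (exists2 t, 0 < t & K < a * (a * (t ^+ n - 1) + b * (t^-1 ^+ n - 1)))
    /\ (exists2 t, 0 < t & K < b * (a * (t ^+ n - 1) + b * (t^-1 ^+ n - 1))).
  split; first exact: scaling_unbounded.
  have [t t0 tK] := scaling_unbounded K n0 b2 a2.
  by exists t^-1; rewrite ?invr_gt0 // invrK addrC.
have k0 : (exists2 t, 0 < t & K1 < a * (t ^+ n - 1) + b * (t^-1 ^+ n - 1)) -> (0 < k)%N.
  case=> t /family[A PA AE] tK.
  by rewrite -(kP A PA) /num_real_eigenvalues AE; apply: K1P.
have k1 :
    (exists2 t, 0 < t & - K0 < - (a * (t ^+ n - 1) + b * (t^-1 ^+ n - 1))) -> k = 0%N.
  case=> t /family[A PA AE]; rewrite ltrN2 => tK.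
  by rewrite -(kP A PA) /num_real_eigenvalues AE K0P // big_nil.
have [[ua1 ub1] [ua0 ub0]] := (unb K1, unb (- K0)).
move=> abN; suff : (0 < k)%N /\ k = 0%N by case=> + k00; rewrite k00.
move: (a2) => /eqP; rewrite sqrf_eq1 => /orP[]/eqP aE.
- have bE : b = -1 by rewrite -abN aE mul1r.
  split; [apply: k0; case: ua1 | apply: k1; case: ub0] => t t0.
    by rewrite {1}aE mul1r; exists t.
  by rewrite {1}bE mulN1r; exists t.
- have bE : b = 1 by apply: oppr_inj; rewrite -abN aE mulN1r.
  split; [apply: k0; case: ub1 | apply: k1; case: ua0] => t t0.
    by rewrite {1}bE mul1r; exists t.
  by rewrite {1}aE mulN1r; exists t.
Qed.

End CycleSpectra.

Theorem theorem4p2 (R : realType) (n : nat) (P : 'M[int]_n)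
    (Psign : sign_pattern P) (Pirr : irreducible P)
    (Psym : comb_symmetric P) (Pdiag : zero_diagonal P)
    (Pcycle : graph_is_cycle (edge P))
    (Pcond : two_nonadjacent_positive_edges P
             \/ several_odd_maximal_signed_paths P
             \/ (odd n /\ exists i j : 'I_n, positive_edge P i j)) :
  ~ consistent R P.
Proof.
have [c [c_uniq c_size c_all Pedge]] := Pcycle.
have few := few_real_eigenvalues R Psign Pdiag c_uniq c_size c_all Pedge.
(* Three real eigenvalues contradict the matrix from [few], which has at most two. *)
have many : (exists2 A : 'M[R]_n, qual_class P A & (2 < num_real_eigenvalues A)%N) ->
    ~ consistent R P.
  case=> A PA A2 [k kP]; case: few => C PC; rewrite (kP C PC) -(kP A PA).
  by rewrite leqNgt A2.
have even_i : ~~ odd n -> two_nonadjacent_positive_edges P -> ~ consistent R P.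
  move=> evn [i [j [k [l [[_ ij] [_ kl] u]]]]]; apply: many.
  exact: (three_eigenvalues_even R Psign evn u ij kl).
have odd_pos : odd n -> (exists i j, positive_edge P i j) -> ~ consistent R P.
  move=> on [i [j [/andP[ij _] es]]]; apply: many.
  apply: (three_eigenvalues_odd R Psign on _ ij es).
  by rewrite -(size_cycle c_uniq c_all).
(* For [n] odd, each condition yields a positive edge. For [n] even, an odd maximal path yields two
   disjoint positive edges or a product of edge signs equal to [-1]. *)
case: Pcond => [Pi|[[x [p [_ [_ [mx _ _ oddp _]]]]]|[on pos]]]; last exact: odd_pos.
- have [on|] := boolP (odd n); last by move/even_i; apply.
  by apply: odd_pos => //; case: Pi => i [j [_ [_ [ij _ _]]]]; exists i, j.
- have [on|evn] := boolP (odd n).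
    have [i es] := maximal_path_positive Psign Psym c_uniq c_size c_all Pedge mx.
    by apply: odd_pos => //; exists i, (next c i); apply: positive_next es.
  have [/(even_i evn)//|] :=
    odd_maximal_path_even Psign Psym c_uniq c_size c_all Pedge evn mx oddp.
  exact: negative_product_not_consistent.
Qed.
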